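(* Let $n\ge2$ and ${\mathbf a}={\mathbf b}={\mathbf c}=\left(\frac1n,\ldots,\frac1n\right)$. (i) For every tensor $P$ of the model $p$-$qI_n$ with these ${\mathbf a},{\mathbf b},{\mathbf c}$ and with parameters $\gamma^{(12)},\gamma^{(13)},\gamma^{(23)}$, setting $$T=\gamma^{(12)}\gamma^{(13)}\gamma^{(23)}+(n-1)(\gamma^{(12)}+\gamma^{(13)}+\gamma^{(23)})+(n-1)(n-2),$$ one has $$\kappa_{12}=\frac{\gamma^{(12)}\gamma^{(13)}\gamma^{(23)}+(n-1)\gamma^{(12)}-\gamma^{(13)}-\gamma^{(23)}-n+2}{T},$$ and similarly $$\kappa_{13}=\frac{\gamma^{(12)}\gamma^{(13)}\gamma^{(23)}+(n-1)\gamma^{(13)}-\gamma^{(12)}-\gamma^{(23)}-n+2}{T},$$ $$\kappa_{23}=\frac{\gamma^{(12)}\gamma^{(13)}\gamma^{(23)}+(n-1)\gamma^{(23)}-\gamma^{(12)}-\gamma^{(13)}-n+2}{T}.$$ (ii) For every tensor $P$ of the model $p$-$mix_n$ with these ${\mathbf a},{\mathbf b},{\mathbf c}$ and with parameters $\alpha^{(0)},\alpha^{(12)},\alpha^{(13)},\alpha^{(23)},\alpha^{(123)}$, one has $$\kappa_{12}=\alpha^{(12)}+\alpha^{(123)},$$ and similarly $\kappa_{13}=\alpha^{(13)}+\alpha^{(123)}$ and $\kappa_{23}=\alpha^{(23)}+\alpha^{(123)}$.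
   Context: $\Delta_{n\times n\times n}$ is the set of real tensors $P=(P_{ijk})_{1\le i,j,k\le n}$ with $P_{ijk}\ge0$ and $\sum_{i,j,k}P_{ijk}=1$. The pairwise quasi-independence model $p$-$qI_n$ is the set of $P\in\Delta_{n\times n\times n}$ of the form: $P_{ijk}=\zeta a_ib_jc_k$ if $i,j,k$ are pairwise distinct; $P_{ijk}=\zeta\gamma^{(12)}a_ib_jc_k$ if $i=j\ne k$; $P_{ijk}=\zeta\gamma^{(13)}a_ib_jc_k$ if $i=k\ne j$; $P_{ijk}=\zeta\gamma^{(23)}a_ib_jc_k$ if $i\ne j=k$; $P_{ijk}=\zeta\gamma^{(12)}\gamma^{(13)}\gamma^{(23)}a_ib_jc_k$ if $i=j=k$. Here ${\mathbf a},{\mathbf b},{\mathbf c}$ are non-negative vectors of length $n$, $\gamma^{(12)},\gamma^{(13)},\gamma^{(23)}$ are non-negative numbers, and $\zeta$ is the normalizing constant (making the entries sum to $1$; in particular the unnormalized entries are not all zero). The pairwise mixture model $p$-$mix_n$ is the set of $P\in\Delta_{n\times n\times n}$ of the form $$P_{ijk}=\alpha^{(0)}a_ib_jc_k+\alpha^{(12)}\frac{\delta_{ij\bullet}}{n^2}+\alpha^{(13)}\frac{\delta_{i\bullet k}}{n^2}+\alpha^{(23)}\frac{\delta_{\bullet jk}}{n^2}+\alpha^{(123)}\frac{\delta_{ijk}}{n},$$ where ${\mathbf a},{\mathbf b},{\mathbf c}$ are non-negative vectors of length $n$ with sum one, the five numbers $\alpha^{(0)},\alpha^{(12)},\alpha^{(13)},\alpha^{(23)},\alpha^{(123)}$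 are non-negative with sum one, and the $\delta$'s are Kronecker symbols: $\delta_{ij\bullet}=1$ if $i=j$ (any $k$), $\delta_{i\bullet k}=1$ if $i=k$ (any $j$), $\delta_{\bullet jk}=1$ if $j=k$ (any $i$), $\delta_{ijk}=1$ if $i=j=k$, and $0$ otherwise. Pairwise Cohen's $\kappa$: for $P\in\Delta_{n\times n\times n}$ let $\tilde P^{(12)}$ be the two-way marginal with entries $\tilde P_{ij}=\sum_{k=1}^nP_{ijk}$, and set $$\kappa_{12}=\frac{\sum_{i=1}^n\tilde P_{ii}-\sum_{i=1}^n\tilde P_{i+}\tilde P_{+i}}{1-\sum_{i=1}^n\tilde P_{i+}\tilde P_{+i}},$$ where $\tilde P_{i+}$ and $\tilde P_{+i}$ are the sums of the $i$-th row and of the $i$-th column of $\tilde P^{(12)}$. The indices $\kappa_{13}$ and $\kappa_{23}$ are defined in the same way from the two-way marginals obtained by summing $P_{ijk}$ over $j$ and over $i$, respectively. *)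

(* Defs.v *)
From mathcomp Require Import all_boot all_order all_algebra.

Set Implicit Arguments.
Unset Strict Implicit.
Unset Printing Implicit Defensive.

Import Order.TTheory GRing.Theory Num.Theory.
Local Open Scope ring_scope.

Definition tensor3 (R : realFieldType) (n : nat) : Type :=
  'I_n -> 'I_n -> 'I_n -> R.

Definition in_simplex (R : realFieldType) (n : nat) (P : tensor3 R n) : Prop :=
  (forall i j k, 0 <= P i j k) /\ \sum_i \sum_j \sum_k P i j k = 1.

Definition nonneg_vec (R : realFieldType) (n : nat) (a : 'rV[R]_n) : Prop :=
  forall i, 0 <= a 0 i.

Definition prob_vec (R : realFieldType) (n : nat) (a : 'rV[R]_n) : Prop :=
  nonneg_vec a /\ \sum_i a 0 i = 1.

Definition uniform_vec (R : realFieldType) (n : nat) : 'rV[R]_n :=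
  const_mx n%:R^-1.

Definition pairwise_qI_factor (R : realFieldType) (n : nat) (g12 g13 g23 : R)
    (i j k : 'I_n) : R :=
  if (i == j) && (j == k) then g12 * g13 * g23
  else if i == j then g12
  else if i == k then g13
  else if j == k then g23
  else 1.

(* Since [P] sums to 1, [zeta] is necessarily the inverse of the
   sum of the unnormalized entries, and that sum is nonzero. *)
Definition pairwise_qI (R : realFieldType) (n : nat) (a b c : 'rV[R]_n)
    (g12 g13 g23 : R) (P : tensor3 R n) : Prop :=
  [/\ in_simplex P,
      [/\ nonneg_vec a, nonneg_vec b & nonneg_vec c],
      [/\ 0 <= g12, 0 <= g13 & 0 <= g23]
    & exists zeta : R, forall i j k,
        P i j k = zeta * pairwise_qI_factor g12 g13 g23 i j k
                  * a 0 i * b 0 j * c 0 k].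

Definition pairwise_mix (R : realFieldType) (n : nat) (a b c : 'rV[R]_n)
    (al0 al12 al13 al23 al123 : R) (P : tensor3 R n) : Prop :=
  [/\ in_simplex P,
      [/\ prob_vec a, prob_vec b & prob_vec c],
      [/\ 0 <= al0, 0 <= al12, 0 <= al13, 0 <= al23 & 0 <= al123],
      al0 + al12 + al13 + al23 + al123 = 1
    & forall i j k,
        P i j k = al0 * a 0 i * b 0 j * c 0 k
                  + al12 * ((i == j)%:R / n%:R ^+ 2)
                  + al13 * ((i == k)%:R / n%:R ^+ 2)
                  + al23 * ((j == k)%:R / n%:R ^+ 2)
                  + al123 * (((i == j) && (j == k))%:R / n%:R)].

Definition marginal12 (R : realFieldType) (n : nat) (P : tensor3 R n) :
  'M[R]_n := \matrix_(i, j) \sum_k P i j k.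

Definition marginal13 (R : realFieldType) (n : nat) (P : tensor3 R n) :
  'M[R]_n := \matrix_(i, k) \sum_j P i j k.

Definition marginal23 (R : realFieldType) (n : nat) (P : tensor3 R n) :
  'M[R]_n := \matrix_(j, k) \sum_i P i j k.

Definition chance_agreement (R : realFieldType) (n : nat) (Q : 'M[R]_n) : R :=
  \sum_i (\sum_j Q i j) * (\sum_j Q j i).

Definition cohen_kappa (R : realFieldType) (n : nat) (Q : 'M[R]_n) : R :=
  (\sum_i Q i i - chance_agreement Q) / (1 - chance_agreement Q).

Definition kappa12 (R : realFieldType) (n : nat) (P : tensor3 R n) : R :=
  cohen_kappa (marginal12 P).

Definition kappa13 (R : realFieldType) (n : nat) (P : tensor3 R n) : R :=
  cohen_kappa (marginal13 P).

Definition kappa23 (R : realFieldType) (n : nat) (P : tensor3 R n) : R :=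
  cohen_kappa (marginal23 P).

(* Main.v *)
(**
With uniform [a], [b], [c], both models consist of tensors
[u + v12 [i = j] + v13 [i = k] + v23 [j = k] + w [i = j = k]].  Each two-way
marginal of such a tensor is [c + d [i = j]], for which the chance agreement is
[1 / n] and Cohen's kappa equals [n d]; for the (1, 2) marginal,
[d = n v12 + w].
*)

Require Import Defs.
From mathcomp Require Import all_boot all_order all_algebra.
From mathcomp Require Import ring.

Set Implicit Arguments.
Unset Strict Implicit.
Unset Printing Implicit Defensive.

Import Order.TTheory GRing.Theory Num.Theory.
Local Open Scope ring_scope.

Lemma sum_delta (R : realFieldType) (n : nat) (j : 'I_n) :
  \sum_i (i == j)%:R = 1 :> R.
Proof.
by rewrite (bigD1 j) //= eqxx big1 ?addr0 // => i /negbTE ->.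
Qed.

Lemma sum_delta_sym (R : realFieldType) (n : nat) (j : 'I_n) :
  \sum_i (j == i)%:R = 1 :> R.
Proof.
rewrite -[RHS](sum_delta R j).
by apply: eq_bigr => i _; rewrite eq_sym.
Qed.

Lemma sum_const_delta (R : realFieldType) (n : nat) (c d : R) (j : 'I_n) :
  \sum_i (c + d * (j == i)%:R) = n%:R * c + d.
Proof.
by rewrite big_split -mulr_sumr sum_delta_sym mulr1 sumr_const card_ord mulr_natl.
Qed.

(** Every row and column of [Q] sums to [n c + d], which the normalization makes [1/n]. Hence the
    numerator of kappa is [(n - 1) d] and the denominator [(n - 1) / n]; the latter is nonzero
    because [n >= 2]. *)
Lemma cohen_kappa_const_delta (R : realFieldType) (n : nat) (Q : 'M[R]_n)
    (c d : R) :
  (2 <= n)%N -> (forall i j, Q i j = c + d * (i == j)%:R) ->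
  n%:R * (n%:R * c + d) = 1 -> cohen_kappa Q = n%:R * d.
Proof.
move=> hn hQ hsum.
have n0 : n%:R != 0 :> R by rewrite pnatr_eq0 -lt0n ltnW.
have n1 : n%:R - 1 != 0 :> R by rewrite subr_eq0 pnatr_eq1 gtn_eqF.
have row i : \sum_j Q i j = n%:R * c + d.
  by rewrite -(sum_const_delta c d i); apply: eq_bigr => j _.
have col i : \sum_j Q j i = n%:R * c + d.
  rewrite -(sum_const_delta c d i).
  by apply: eq_bigr => j _; rewrite hQ eq_sym.
have diag : \sum_i Q i i = n%:R * (c + d).
  rewrite (eq_bigr (fun=> c + d)) => [|i _]; last by rewrite hQ eqxx mulr1.
  by rewrite sumr_const card_ord mulr_natl.
have s_eq : n%:R * c + d = n%:R^-1 by apply: (mulfI n0); rewrite hsum divff.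
have chance : chance_agreement Q = n%:R^-1.
  rewrite /chance_agreement (eq_bigr (fun=> n%:R^-1 * n%:R^-1)) => [|i _].
    by rewrite sumr_const card_ord -[LHS]mulr_natl mulVKf.
  by rewrite row col s_eq.
have c_eq : c = (n%:R^-1 - d) / n%:R by apply: (canRL (mulfK n0)); rewrite -s_eq addrK mulrC.
by rewrite /cohen_kappa diag chance c_eq; field; rewrite n0 n1.
Qed.

Section DeltaTensor.

Variables (R : realFieldType) (n : nat) (u v12 v13 v23 w : R).
Variable P : tensor3 R n.
Hypothesis hP : forall i j k,
  P i j k = u + v12 * (i == j)%:R + v13 * (i == k)%:R + v23 * (j == k)%:R
            + w * ((i == j) && (j == k))%:R.

Let sum_affine (I : finType) (f g h : I -> R) (x a b c : R) :
  \sum_i (x + a * f i + b * g i + c * h i)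
  = #|I|%:R * x + a * (\sum_i f i) + b * (\sum_i g i) + c * (\sum_i h i).
Proof. by rewrite !big_split /= !mulr_sumr sumr_const mulr_natl. Qed.

Lemma marginal12_delta i j :
  marginal12 P i j
  = (n%:R * u + v13 + v23) + (n%:R * v12 + w) * (i == j)%:R.
Proof.
(* With [i] and [j] fixed, [[i = j]] is a constant and [[i = j = k]] splits as [[i = j] [j = k]], so
   the summand is affine in indicators that each sum to 1 over [k]. *)
rewrite mxE (eq_bigr (fun k => (u + v12 * (i == j)%:R) + v13 * (i == k)%:R
  + v23 * (j == k)%:R + (w * (i == j)%:R) * (j == k)%:R)) => [|k _].
  by rewrite sum_affine card_ord !sum_delta_sym; ring.
by rewrite hP -mulnb natrM mulrA.
Qed.

Lemma marginal13_delta i k :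
  marginal13 P i k
  = (n%:R * u + v12 + v23) + (n%:R * v13 + w) * (i == k)%:R.
Proof.
(* Here the triple indicator is split as [[i = k] [i = j]], so that its first factor is constant in
   [j]. *)
rewrite mxE (eq_bigr (fun j => (u + v13 * (i == k)%:R) + v12 * (i == j)%:R
  + v23 * (j == k)%:R + (w * (i == k)%:R) * (i == j)%:R)) => [|j _].
  by rewrite sum_affine card_ord !sum_delta_sym sum_delta; ring.
rewrite hP; have [->|_] := eqVneq i j => /=; ring.
Qed.

Lemma marginal23_delta j k :
  marginal23 P j k
  = (n%:R * u + v12 + v13) + (n%:R * v23 + w) * (j == k)%:R.
Proof.
rewrite mxE (eq_bigr (fun i => (u + v23 * (j == k)%:R) + v12 * (i == j)%:R
  + v13 * (i == k)%:R + (w * (j == k)%:R) * (i == j)%:R)) => [|i _].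
  by rewrite sum_affine card_ord !sum_delta; ring.
by rewrite hP -mulnb natrM; ring.
Qed.

Lemma total_delta :
  \sum_i \sum_j \sum_k P i j k
  = n%:R * (n%:R ^+ 2 * u + n%:R * (v12 + v13 + v23) + w).
Proof.
rewrite (eq_bigr (fun=> n%:R * (n%:R * u + v13 + v23) + (n%:R * v12 + w))).
  by rewrite sumr_const card_ord -mulr_natl; ring.
move=> i _; rewrite -(sum_const_delta _ _ i).
by apply: eq_bigr => j _; rewrite -marginal12_delta mxE.
Qed.

(** Each marginal has the total mass of [P], so the single equation from [total_delta] supplies the
    normalization for all three. *)
Lemma kappa_delta : (2 <= n)%N -> in_simplex P ->
  [/\ kappa12 P = n%:R * (n%:R * v12 + w),
      kappa13 P = n%:R * (n%:R * v13 + w)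
    & kappa23 P = n%:R * (n%:R * v23 + w)].
Proof.
move=> hn [_]; rewrite total_delta => total.
split; [apply: (cohen_kappa_const_delta hn marginal12_delta)
      | apply: (cohen_kappa_const_delta hn marginal13_delta)
      | apply: (cohen_kappa_const_delta hn marginal23_delta)];
  by rewrite -[RHS]total; ring.
Qed.

End DeltaTensor.

(** Any two of the equalities force the third, so off the main diagonal at most one indicator is 1.
    On it all are 1, and the last coefficient corrects [g12 + g13 + g23 - 2] to the product. *)
Lemma pairwise_qI_factor_delta (R : realFieldType) (n : nat) (g12 g13 g23 : R)
    (i j k : 'I_n) :
  pairwise_qI_factor g12 g13 g23 i j k
  = 1 + (g12 - 1) * (i == j)%:R + (g13 - 1) * (i == k)%:R
    + (g23 - 1) * (j == k)%:R
    + (g12 * g13 * g23 - g12 - g13 - g23 + 2) * ((i == j) && (j == k))%:R.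
Proof.
rewrite /pairwise_qI_factor; have [<-|ij] := eqVneq i j.
  by case: (i == k) => /=; ring.
have [<-|_] := eqVneq i k; last by case: (j == k) => /=; ring.
by rewrite eq_sym (negbTE ij) /=; ring.
Qed.

Theorem proposition7p1 (R : realFieldType) (n : nat) (hn : (2 <= n)%N) :
  (forall (P : tensor3 R n) (g12 g13 g23 : R),
     pairwise_qI (uniform_vec R n) (uniform_vec R n) (uniform_vec R n)
       g12 g13 g23 P ->
     let T := g12 * g13 * g23 + (n%:R - 1) * (g12 + g13 + g23)
              + (n%:R - 1) * (n%:R - 2) in
     [/\ kappa12 P = (g12 * g13 * g23 + (n%:R - 1) * g12 - g13 - g23
                      - n%:R + 2) / T,
         kappa13 P = (g12 * g13 * g23 + (n%:R - 1) * g13 - g12 - g23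
                      - n%:R + 2) / T
       & kappa23 P = (g12 * g13 * g23 + (n%:R - 1) * g23 - g12 - g13
                      - n%:R + 2) / T])
  /\
  (forall (P : tensor3 R n) (al0 al12 al13 al23 al123 : R),
     pairwise_mix (uniform_vec R n) (uniform_vec R n) (uniform_vec R n)
       al0 al12 al13 al23 al123 P ->
     [/\ kappa12 P = al12 + al123,
         kappa13 P = al13 + al123
       & kappa23 P = al23 + al123]).
Proof.
have n0 : n%:R != 0 :> R by rewrite pnatr_eq0 -lt0n ltnW.
split=> [P g12 g13 g23 [simP _ _ [zeta hP]] T
       |P al0 al12 al13 al23 al123 [simP _ _ _ hP]].
  (* The three uniform vectors contribute the factor [1 / n ^ 3]. *)
  pose z := zeta / n%:R ^+ 3.
  have hD i j k : P i j k = z + z * (g12 - 1) * (i == j)%:R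
      + z * (g13 - 1) * (i == k)%:R + z * (g23 - 1) * (j == k)%:R
      + z * (g12 * g13 * g23 - g12 - g13 - g23 + 2) * ((i == j) && (j == k))%:R.
    by rewrite hP !mxE pairwise_qI_factor_delta /z; field.
  (* Total mass 1 determines [zeta]: the sum of all entries is [n z T]. This also shows that [T] is
     nonzero. *)
  have zT : n%:R * z * T = 1.
    by rewrite -[RHS]simP.2 (total_delta hD) /T; ring.
  have T0 : T != 0.
    by apply/eqP => T0; move/eqP: zT; rewrite T0 mulr0 eq_sym oner_eq0.
  have [-> -> ->] := kappa_delta hD hn simP.
  (* Each kappa is [n z] times the claimed numerator, and [n z] is the inverse of [T]. *)
  split; apply: (mulIf T0); rewrite divfK //;
    by rewrite -[RHS]mul1r -[X in _ = X * _]zT; ring.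
(* With [v12 = al12 / n ^ 2] and [w = al123 / n], all powers of [n] cancel in [n (n v12 + w)]. *)
have hD i j k : P i j k = al0 / n%:R ^+ 3 + al12 / n%:R ^+ 2 * (i == j)%:R
    + al13 / n%:R ^+ 2 * (i == k)%:R + al23 / n%:R ^+ 2 * (j == k)%:R
    + al123 / n%:R * ((i == j) && (j == k))%:R.
  by rewrite hP !mxE; field.
have [-> -> ->] := kappa_delta hD hn simP.
by split; field.
Qed.
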